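(* Assume that the following statement (S) holds. (S) For every fixed $\varepsilon>0$ there exists $\delta$ with $0<\delta<\varepsilon$ such that for all sufficiently large integers $k$ the following is true. Let $p_1<p_2<\ldots<p_r$ be all the primes strictly between $\sqrt k$ and $k$, let $M=\prod_{j=1}^r p_j$, and for every $1\le j\le r$ let $I_j=\{1,2,\ldots,\lceil p_j^{1-\delta}\rceil\}$. Then among every $\lceil M^{\varepsilon}\rceil$ consecutive integers there is at least one value $x$ for which $x \bmod p_j$ belongs to $I_j$ for every $1\le j\le r$. Then for every constant $C\ge 1$ there exist integers $k\geq 1$ and $0<x<y$ with $y>x+k$ such that $$\operatorname{lcm}\{x,x+1,\ldots,x+k-1\} > \operatorname{lcm}\{y,y+1,\ldots,y+k+C-1\}.$$
   Context: $a \bmod n$ denotes the unique integer between $0$ and $n-1$ that is congruent to $a$ modulo $n$. $\operatorname{lcm}$ of a finite set of positive integers is the smallest positive integer divisible by each of them. The set $\{y,y+1,\ldots,y+k+C-1\}$ denotes the set of integers $i$ with $y\le i\le y+k+C-1$ (so it has $k+C$ elements when $C$ is an integer). *)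

(* Defs.v *)
From HB Require Import structures.
From mathcomp Require Import all_boot all_order all_algebra.
From mathcomp Require Import all_classical all_reals all_analysis.

Set Implicit Arguments.
Unset Strict Implicit.
Unset Printing Implicit Defensive.

Import Order.TTheory GRing.Theory Num.Theory.
Local Open Scope ring_scope.

Section Defs.
Variable R : realType.

Definition sieve_prime (k p : nat) : bool :=
  [&& prime p, Num.sqrt (k%:R : R) < p%:R & (p < k)%N].

Definition sieve_modulus (k : nat) : nat :=
  (\prod_(p < k | sieve_prime k p) p)%N.

Definition residue_set (delta : R) (p : nat) : pred int :=
  [pred a : int | 1 <= a <= Num.ceil ((p%:R : R) `^ (1 - delta))].

(* A block of consecutive integers is given by its first element a, which may *)
(* be negative; (x %% p)%Z is the residue of x in [0, p - 1].                 *)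
Definition sieve_hypothesis : Prop :=
  forall epsilon : R, 0 < epsilon ->
  exists delta : R, 0 < delta < epsilon /\
  exists k0 : nat, forall k : nat, (k0 <= k)%N ->
  forall a : int, exists x : int,
    a <= x < a + Num.ceil (((sieve_modulus k)%:R : R) `^ epsilon) /\
    forall p : nat, sieve_prime k p -> (x %% p%:Z)%Z \in residue_set delta p.

(* The integers i with m <= i <= b, for a real bound b >= 0. *)
Definition nat_range (m : nat) (b : R) : seq nat :=
  index_iota m (Num.truncn b).+1.

Lemma mem_nat_range (m : nat) (b : R) (i : nat) : 0 <= b ->
  (i \in nat_range m b) = (m <= i)%N && (i%:R <= b).
Proof. by move=> b0; rewrite mem_index_iota ltnS truncn_ge_nat. Qed.

End Defs.

Definition lcm_seq (s : seq nat) : nat := \big[lcmn/1%N]_(i <- s) i.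

(* Main.v *)
Require Import Defs.
From HB Require Import structures.
From mathcomp Require Import all_boot all_order all_algebra.
From mathcomp Require Import all_classical all_reals all_analysis.
From mathcomp Require Import zify lra.

Set Implicit Arguments.
Unset Strict Implicit.
Unset Printing Implicit Defensive.

Import Order.TTheory GRing.Theory Num.Theory.

(** Write [k = r * r] and [K = k + c], where [c] is the integral part of [C].
The lcm of a block of consecutive integers is the product of the block divided
by a correction: for every prime power [p ^ j] that divides [N > 0] terms of
the block, the lcm loses [N - 1] factors [p].  The block that starts at [x] has
either the floor or the ceiling of [k / p ^ j] multiples of [p ^ j], so the
correction depends on the residues of [x] modulo these prime powers.

The sieve provides [x] slightly above a multiple of every prime
[r < p < k], so that a block of length [k] from [x] meets as few multiples of
[p] as possible.  Applied to an interval of negative integers, it also provides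
[y] slightly below a multiple of every such [p], so that a block from [y] meets
as many as possible.  Unless [p] divides an integer at distance at most [L] from
[k], where [L] bounds the residues allowed by the sieve, the second block
contains one more multiple of [p] than the first.  Thus the correction for the
block of [y] exceeds the one for the block of [x] by a factor of about [M], the
product of all these primes.  Two things limit this gain, both by at most
[exp (o(k))]: the primes [p <= r], where each [p] costs at most [k] (factor
[small_part]), and the primes that divide an integer close to [k], which all
divide [window_product k L].  This comparison, made prime by prime, is the
divisibility [lcm_exchange].

The price is that [y] is larger than [x] and that its block has [c] more terms.
The sieve works in intervals of length [w], about [M] to the power [1 / (4 c)].
If [x] and [y] are both about [W ^ 2], at distance [O(W)] with [W = 6 k w], then
the first [k] terms of the two blocks have products within a factor 2
([prod_block_le]), and the [c] extra terms cost about [W ^ (2 c)], which is the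
square root of [M] up to a factor that is polynomial in [k].  Hence the gain [M]
prevails ([lcm_lt]) as soon as [M] exceeds those factors.  The lower bound on
[M] is Chebyshev's ([chebyshev_lower]), read off the central binomial
coefficient.  Taking [r], [k] and [L] to be powers of 2 makes the final
comparison of sizes a comparison of exponents ([parameters_suffice]). *)

(** * Valuations as counts of dividing prime powers *)

Lemma dvdn_logn (m n : nat) : 0 < m -> 0 < n ->
  (forall p, prime p -> logn p m <= logn p n) -> m %| n.
Proof.
move=> m0 n0 h; apply/(dvdn_partP _ m0) => p.
rewrite mem_primes => /andP[pp _].
by rewrite p_part pfactor_dvdn // h.
Qed.

Lemma sum_nat_leq_indicator (v b : nat) :
  \sum_(1 <= j < b.+1) (j <= v) = minn v b.
Proof.
elim: b => [|b IH]; first by rewrite big_geq // minn0.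
by rewrite big_nat_recr //= IH; lia.
Qed.

(** Any bound [b >= n] on the exponents will do; a common one lets the sums for
different [n] be added term by term. *)
Lemma logn_count_pfactor (p n b : nat) : prime p -> 0 < n -> n <= b ->
  logn p n = \sum_(1 <= j < b.+1) (p ^ j %| n).
Proof.
move=> pp n0 nb.
under eq_bigr do rewrite pfactor_dvdn //.
rewrite sum_nat_leq_indicator; apply/esym/minn_idPl.
by apply: leq_trans nb; apply/ltnW/ltn_logl.
Qed.

Definition multiples_in (d a n : nat) : nat := \sum_(a <= i < a + n) (d %| i).

Lemma multiples_in_divn (d a n : nat) : 0 < d ->
  a %/ d + multiples_in d a.+1 n = (a + n) %/ d.
Proof.
move=> d0; rewrite /multiples_in; elim: n => [|n IH].
  by rewrite !addn0 big_geq ?addn0.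
by rewrite !addnS big_nat_recr ?leq_addr //= addnA -addSn IH addSn divnS // addnC.
Qed.

Lemma multiples_in_bounds (d a n : nat) : 0 < d -> 0 < a ->
  n %/ d <= multiples_in d a n <= (n %/ d).+1.
Proof.
case: a => // a d0 _; have := multiples_in_divn a n d0.
have := leq_divDl d a n; rewrite divnD //; lia.
Qed.

Lemma logn_prod_iota (p a n b : nat) : prime p -> 0 < a -> a + n <= b ->
  logn p (\prod_(a <= i < a + n) i) =
  \sum_(1 <= j < b.+1) multiples_in (p ^ j) a n.
Proof.
move=> pp a0; rewrite /multiples_in; elim: n => [|n IH] hb.
  by rewrite addn0 big_geq // logn1 big1 // => j _; rewrite big_geq.
rewrite addnS big_nat_recr ?leq_addr //= lognM; last 2 first.
- by rewrite big_nat prodn_cond_gt0 // => i; lia.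
- lia.
rewrite IH; last lia.
rewrite (@logn_count_pfactor p (a + n) b) //; [|lia|lia].
rewrite -big_split /=; apply: eq_bigr => j _.
by rewrite big_nat_recr ?leq_addr.
Qed.

Lemma lcm_seq_gt0 (s : seq nat) : all (leq 1) s -> 0 < lcm_seq s.
Proof.
rewrite /lcm_seq; elim: s => [|i s IH] /=; first by rewrite big_nil.
by case/andP=> i0 /IH h; rewrite big_cons lcmn_gt0 i0.
Qed.

(** The valuation of an lcm is the largest valuation of a term. *)
Lemma pfactor_dvd_lcm_seq (p j : nat) (s : seq nat) : prime p -> 0 < j ->
  all (leq 1) s -> (p ^ j %| lcm_seq s) = has (fun i => p ^ j %| i) s.
Proof.
move=> pp j0; rewrite /lcm_seq; elim: s => [|i s IH] /=.
  by rewrite big_nil dvdn1 -(expn0 p) eqn_exp2l ?prime_gt1 //; lia.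
case/andP=> i0 hs; have l0 := lcm_seq_gt0 hs.
rewrite big_cons pfactor_dvdn ?lcmn_gt0 ?i0 // logn_lcm // leq_max.
by rewrite -!pfactor_dvdn // -IH.
Qed.

Lemma all_iota_gt0 (a n : nat) : 0 < a -> all (leq 1) (index_iota a (a + n)).
Proof. by move=> a0; apply/allP => i; rewrite mem_index_iota; lia. Qed.

(** Compared with [logn_prod_iota], only whether a multiple of [p ^ j] occurs
counts: this is the correction between the product and the lcm. *)
Lemma logn_lcm_iota (p a n b : nat) : prime p -> 0 < a -> a + n <= b ->
  logn p (lcm_seq (index_iota a (a + n))) =
  \sum_(1 <= j < b.+1) (0 < multiples_in (p ^ j) a n).
Proof.
move=> pp a0 hb; have hs := all_iota_gt0 n a0; have l0 := lcm_seq_gt0 hs.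
have has_mult d : has (dvdn d) (index_iota a (a + n)) = (0 < multiples_in d a n).
  by rewrite lt0n sum_nat_seq_neq0; apply: eq_has => i /=; case: (d %| i).
(* Otherwise a term of the block would be divisible by [p ^ b.+1], which lies
beyond the end of the block. *)
have /minn_idPl <- : logn p (lcm_seq (index_iota a (a + n))) <= b.
  rewrite leqNgt; apply/negP => hlt.
  have: p ^ b.+1 %| lcm_seq (index_iota a (a + n)) by rewrite pfactor_dvdn.
  rewrite pfactor_dvd_lcm_seq // => /hasP[i]; rewrite mem_index_iota => hi.
  move=> /dvdn_leq; have := ltn_expl b.+1 (prime_gt1 pp); lia.
rewrite -sum_nat_leq_indicator; apply: eq_big_nat => j /andP[j0 _].
by rewrite -pfactor_dvdn // pfactor_dvd_lcm_seq // has_mult.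
Qed.

Lemma logn_prod_primes (P : pred nat) (e : nat -> nat) (n q : nat) : prime q ->
  (forall p, P p -> prime p) ->
  logn q (\prod_(p < n | P p) p ^ e p) = if (q < n) && P q then e q else 0.
Proof.
move=> pq hP; rewrite big_mkcond /=; elim: n => [|n IH].
  by rewrite big_ord0 logn1.
rewrite big_ord_recr /= lognM; last 2 first.
- by apply: prodn_gt0 => i; case: ifP => // /hP/prime_gt0 i0; rewrite expn_gt0 i0.
- by case: ifP => // /hP/prime_gt0 i0; rewrite expn_gt0 i0.
rewrite IH; case Pn: (P n).
  rewrite lognX logn_prime ?hP // ltnS (leq_eqVlt q).
  have [->|_] := eqVneq q n; first by rewrite ltnn Pn muln1.
  by rewrite muln0 addn0.
rewrite logn1 addn0 ltnS (leq_eqVlt q).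
by have [->|] := eqVneq q n => //; rewrite ltnn Pn.
Qed.

(** * The Chebyshev bound *)

(** This is [sieve_modulus] for [k = r * r]: see [sieve_modulus_square]. *)
Definition medium_primorial (r : nat) : nat :=
  \prod_(p < r * r | prime p && (r < p)) p.

(** The part of lcm(1, ..., r * r) made of the primes up to [r]. *)
Definition small_part (r : nat) : nat :=
  \prod_(p < r.+1 | prime p) p ^ trunc_log p (r * r).

Lemma logn_medium_primorial (r p : nat) : prime p ->
  logn p (medium_primorial r) = (r < p < r * r).
Proof.
move=> pp; pose P q := prime q && (r < q).
have -> : medium_primorial r = \prod_(q < r * r | P q) q ^ 1.
  by apply: eq_bigr => q _; rewrite expn1.
rewrite (@logn_prod_primes P (fun=> 1)) //; last by move=> q /andP[].
by rewrite /P pp andbC; case: andb.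
Qed.

Lemma logn_small_part (r p : nat) : prime p ->
  logn p (small_part r) = if p <= r then trunc_log p (r * r) else 0.
Proof.
by move=> pp; rewrite /small_part (@logn_prod_primes prime (fun p => trunc_log p (r * r))) // ltnS pp andbT.
Qed.

Lemma medium_primorial_gt0 r : 0 < medium_primorial r.
Proof. by apply: prodn_cond_gt0 => i /andP[/prime_gt0]. Qed.

Lemma small_part_gt0 r : 0 < small_part r.
Proof. by apply: prodn_cond_gt0 => i /prime_gt0 i0; rewrite expn_gt0 i0. Qed.

Lemma small_part_le r : 0 < r -> small_part r <= (r * r) ^ r.
Proof.
move=> r0; rewrite /small_part big_mkcond big_ord_recl /= mul1n.
rewrite -[X in _ ^ X]card_ord -prod_nat_const; apply: leq_prod => i _.
case: ifP => [/prime_gt1 p1|_]; last by rewrite muln_gt0 r0.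
by apply: trunc_logP; rewrite // muln_gt0 r0.
Qed.

(** If [p > r], at most one power of [p] with positive exponent is at most
[r * r], namely [p] itself.  As
[r * r] is not a prime, every prime of ]r, r * r] divides
[medium_primorial r]. *)
Lemma prime_power_count (r p b : nat) : prime p -> 1 < r ->
  \sum_(1 <= j < b) (p ^ j <= r * r) <=
  logn p (small_part r) + logn p (medium_primorial r).
Proof.
move=> pp r1; have p1 := prime_gt1 pp.
rewrite logn_small_part // logn_medium_primorial //.
case: b => [|b]; first by rewrite big_geq.
have [pr|rp] := leqP p r.
  rewrite /= addn0; apply: (@leq_trans (\sum_(1 <= j < b.+1) (j <= trunc_log p (r * r)))).
    apply: leq_sum => j _; case h: (p ^ j <= _) => //.
    by rewrite (trunc_log_max p1 h).
  by rewrite sum_nat_leq_indicator geq_minl.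
rewrite add0n; case: (ltnP p (r * r)) => [_|hp] /=.
  apply: (@leq_trans (\sum_(1 <= j < b.+1) (j <= 1))).
    apply: leq_sum => -[|[|j]] _; rewrite ?leq_b1 //.
    have pj : p * p <= p ^ j.+2 by rewrite !expnS mulnA leq_pmulr // expn_gt0; lia.
    by case: leqP => // pjr; nia.
  by rewrite sum_nat_leq_indicator geq_minl.
rewrite leqn0; apply/eqP; rewrite big_nat_cond; apply: big1 => j /andP[/andP[j0 _] _].
have pj : p <= p ^ j by rewrite -{1}(expn1 p) leq_exp2l.
have : p != r * r.
  apply/eqP => e; have /primeP[_ /(_ r)] := pp.
  rewrite e dvdn_mulr // => /(_ isT)/orP[]/eqP; nia.
by case: leqP => //; lia.
Qed.

Lemma leq_exp2_central_bin n : 2 ^ n <= 'C(n.*2, n).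
Proof.
elim: n => // n IH; rewrite doubleS binS expnS mul2n -addnn.
rewrite binS; have := @leq_bin2l n.*2 n.*2.+1 n.
by have := leq_addl 'C(n.*2, n.+1) 'C(n.*2, n); lia.
Qed.

(** By Legendre's formula, each power [p ^ j <= n.*2] contributes at most 1 to
the valuation of the central binomial coefficient, and the larger powers
contribute nothing. *)
Lemma central_bin_dvd (r n : nat) : 1 < r -> n.*2 = r * r ->
  'C(n.*2, n) %| small_part r * medium_primorial r.
Proof.
move=> r1 hn; have b0 : 0 < 'C(n.*2, n) by rewrite bin_gt0; lia.
apply: dvdn_logn => //; first by rewrite muln_gt0 small_part_gt0 medium_primorial_gt0.
move=> p pp; rewrite lognM ?small_part_gt0 ?medium_primorial_gt0 //.
apply: leq_trans (prime_power_count n.*2.+1 pp r1).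
have := @bin_fact n.*2 n; rewrite -addnn leq_addr addnK => /(_ isT)/(congr1 (logn p)).
rewrite !lognM ?muln_gt0 ?fact_gt0 ?addnn // logn_fact // logn_fact //.
have -> : \sum_(1 <= j < n.+1) n %/ p ^ j = \sum_(1 <= j < n.*2.+1) n %/ p ^ j.
  rewrite [RHS](big_cat_nat _ (n := n.+1)) //=; last by lia.
  rewrite [X in _ = _ + X]big_nat_cond [X in _ = _ + X]big1 ?addn0 // => j.
  rewrite andbT => /andP[nj _]; apply: divn_small.
  by apply: ltn_trans nj (ltn_expl _ (prime_gt1 pp)).
set S := \sum_(1 <= j < n.*2.+1) n %/ p ^ j => e.
rewrite -(leq_add2r S.*2) e -[S.*2]addnn -!big_split /=; apply: leq_sum => j _.
have d0 : 0 < p ^ j by rewrite expn_gt0 prime_gt0.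
rewrite -hn; case: (leqP (p ^ j) n.*2) => h; last by rewrite divn_small.
by have := leq_divDl (p ^ j) n n; rewrite addnn; lia.
Qed.

Lemma chebyshev_lower (r n : nat) : 1 < r -> n.*2 = r * r ->
  2 ^ n <= small_part r * medium_primorial r.
Proof.
move=> r1 hn; apply: leq_trans (leq_exp2_central_bin n) _.
by apply: dvdn_leq (central_bin_dvd r1 hn); rewrite muln_gt0 small_part_gt0 medium_primorial_gt0.
Qed.

(** * Comparing two blocks of consecutive integers *)

(** A prime [p] with a multiple within [L] of [k] may fail to separate the two
blocks; all such primes divide this product, so it bounds their total effect
without counting them. *)
Definition window_product (k L : nat) : nat := \prod_(k - L <= i < k + L) i.

Lemma window_product_gt0 k L : L < k -> 0 < window_product k L.
Proof. by move=> h; rewrite /window_product big_nat prodn_cond_gt0 // => i; lia. Qed.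

Lemma window_product_le k L : L < k -> window_product k L <= (2 * k) ^ (2 * L).
Proof.
move=> h; rewrite /window_product big_nat.
have -> : 2 * L = (k + L) - (k - L) by lia.
rewrite -prod_nat_const_nat [X in _ <= X]big_nat.
by apply: leq_prod => i; lia.
Qed.

Lemma dvdn_window_product k L d : k - L <= d -> d < k + L -> d %| window_product k L.
Proof.
move=> h1 h2; rewrite /window_product (big_rem d) ?mem_index_iota ?h1 //=.
exact: dvdn_mulr.
Qed.

Lemma multiples_in_residue (p x k : nat) : 0 < p -> 0 < x %% p ->
  multiples_in p x k = (x %% p - 1 + k) %/ p.
Proof.
move=> p0 s0; have s1 := ltn_pmod x p0.
have x0 : 0 < x by case: x s0 {s1} => //; rewrite mod0n.
have := multiples_in_divn x.-1 k p0; rewrite prednK //.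
have := divn_eq x p; move: (x %/ p) (x %% p) s0 s1 => q s s0 s1 e.
have -> : x.-1 = q * p + (s - 1) by lia.
by rewrite -addnA !divnMDl // [X in _ + X + _]divn_small; lia.
Qed.

Lemma multiples_in_before_multiple (p y k K t : nat) : 0 < t < p -> 0 < y -> p %| y + t ->
  t <= k < K -> (k - t) %/ p < multiples_in p y K.
Proof.
move=> /andP[t0 tp] y0 /dvdnP[q e] /andP[tk kK].
have p0 : 0 < p by lia.
have q0 : 0 < q by case: q e; lia.
have := multiples_in_divn y.-1 K p0; rewrite prednK //.
have -> : y.-1 = (q.-1) * p + (p - t - 1) by case: q e q0 => //= q; lia.
rewrite -addnA !divnMDl // [X in _ + X + _]divn_small; last lia.
have : (p + (k - t)) %/ p <= (p - t - 1 + K) %/ p by apply: leq_div2r; lia.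
rewrite divnDl ?dvdnn // divnn p0; lia.
Qed.

(** If [p] has no multiple in [k - L, k + L[, then shifting [k] by less than [L]
does not change its quotient by [p], so both counts are governed by [k %/ p]. *)
Lemma multiples_in_gain (p x y k K L t : nat) :
  ~~ (p %| window_product k L) ->
  0 < x %% p <= L -> 0 < t < p -> t <= L -> L < k -> 0 < y -> p %| y + t -> k < K ->
  multiples_in p x k < multiples_in p y K.
Proof.
move=> np /andP[s0 sL] tp tL Lk y0 yt kK; have p0 : 0 < p by lia.
rewrite multiples_in_residue //.
apply: leq_ltn_trans (multiples_in_before_multiple (k := k) tp y0 yt _); last by lia.
rewrite leqNgt; apply: contra np => h.
set a := (x %% p - 1 + k) %/ p in h; have ap : a * p <= x %% p - 1 + k by apply: leq_trunc_div.
apply: dvdn_trans (dvdn_mull a (dvdnn p)) _; apply: dvdn_window_product; last by lia.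
by move: h; rewrite ltn_divLR //; lia.
Qed.

(** For each prime, the valuations of the two sides are sums over [j] of counts
of multiples of [p ^ j].  In general the block of [x] has at most one multiple
of [p ^ j] more than the block of [y], and only if [p ^ j <= r * r]; this loss is paid by
[small_part] if [p <= r].  If [r < p < r * r], either [p] divides the window
product, whose square pays for the loss and for the factor [p] of the
primorial, or [multiples_in_gain] supplies that factor. *)
Lemma lcm_exchange (r x y c L : nat) : 1 < r -> L < r * r ->
  0 < x -> 0 < y -> 0 < c ->
  (forall p, prime p -> r < p < r * r -> 0 < x %% p <= L) ->
  (forall p, prime p -> r < p < r * r ->
    exists t, [/\ 0 < t < p, t <= L & p %| y + t]) ->
  medium_primorial r * (\prod_(x <= i < x + r * r) i *
     lcm_seq (index_iota y (y + (r * r + c)))) %|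
  \prod_(y <= i < y + (r * r + c)) i * lcm_seq (index_iota x (x + r * r)) *
    (small_part r * window_product (r * r) L ^ 2).
Proof.
move=> r1 Lk x0 y0 c0 hx hy; set k := r * r in Lk hx hy *; set K := k + c.
set lx := lcm_seq (index_iota x _); set ly := lcm_seq _.
have lx0 : 0 < lx by apply/lcm_seq_gt0/all_iota_gt0.
have ly0 : 0 < ly by apply/lcm_seq_gt0/all_iota_gt0.
have prod0 a n : 0 < a -> 0 < \prod_(a <= i < a + n) i.
  by move=> a0; rewrite big_nat prodn_cond_gt0 // => i; lia.
have [Px0 Py0] := (prod0 x k x0, prod0 y K y0).
have B0 := window_product_gt0 Lk.
have M0 := medium_primorial_gt0 r; have G0 := small_part_gt0 r.
apply: dvdn_logn; rewrite ?muln_gt0 ?expn_gt0 ?M0 ?G0 ?B0 ?lx0 ?ly0 ?Px0 ?Py0 //.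
move=> p pp; have p0 := prime_gt0 pp.
rewrite !lognM ?muln_gt0 ?expn_gt0 ?M0 ?G0 ?B0 ?lx0 ?ly0 ?Px0 ?Py0 //.
set b := x + y + K.
rewrite !(@logn_prod_iota _ _ _ b) // ?(@logn_lcm_iota _ _ _ b) //; try lia.
have pj0 j : 0 < p ^ j by rewrite expn_gt0 p0.
pose N a n j := multiples_in (p ^ j) a n.
have bounds j : (k %/ p ^ j <= N x k j <= (k %/ p ^ j).+1) /\ k %/ p ^ j <= N y K j.
  split; first exact: multiples_in_bounds.
  have /andP[+ _] := multiples_in_bounds K (pj0 j) y0; apply: leq_trans.
  by apply: leq_div2r; rewrite leq_addr.
have termwise j :
    N x k j + (0 < N y K j) <= N y K j + (0 < N x k j) + (p ^ j <= k).
  have [] := bounds j; case: (leqP (p ^ j) k) => h.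
    have : 0 < k %/ p ^ j by rewrite divn_gt0.
    lia.
  by rewrite divn_small //; lia.
pose S f := \sum_(1 <= j < b.+1) f j : nat.
have SD f g : S (fun j => f j + g j) = S f + S g by rewrite /S big_split.
have leS f g : (forall j, f j <= g j) -> S f <= S g.
  by move=> fg; apply: leq_sum => j _.
set PX := S (N x k); set PY := S (N y K).
set LX := S (fun j => nat_of_bool (0 < N x k j)).
set LY := S (fun j => nat_of_bool (0 < N y K j)).
suff : logn p (medium_primorial r) + (PX + LY) <= PY + LX +
  (logn p (small_part r) +
   (logn p (window_product k L) + logn p (window_product k L))) by [].
have := leS _ _ termwise; rewrite !SD -/PX -/PY -/LX -/LY => loss.
have := prime_power_count b.+1 pp r1; rewrite -/(S _) -/k => cost.
rewrite logn_medium_primorial // -/k in cost *.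
have [rpk|npk] := boolP (r < p < k); last by rewrite (negbTE npk) in cost; lia.
have /andP[rp pk] := rpk; rewrite rpk in cost.
have [bad|good] := boolP (p %| window_product k L).
  have : 0 < logn p (window_product k L) by rewrite logn_gt0 mem_primes pp B0.
  by move: cost; rewrite logn_small_part // (leqNgt p r) rp; lia.
have [t [tp tL yt]] := hy p pp rpk.
have kK : k < K by rewrite /K; lia.
have gain := multiples_in_gain good (hx p pp rpk) tp tL Lk y0 yt kK.
(* The term [j == 0] only serves to state the bound for every [j]: the sums start
at 1. *)
have gainwise j : N x k j + (0 < N y K j) + (j == 1) <=
    N y K j + (0 < N x k j) + (j == 0).
  case: j => [|[|j]].
  - by have := termwise 0; rewrite expn0; lia.
  - have [] := bounds 1; have : 0 < k %/ p by rewrite divn_gt0 // ltnW.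
    by move: gain; rewrite /N expn1; lia.
  - have := termwise j.+2; case: (leqP (p ^ j.+2) k) => [pk2|_ /=]; last by lia.
    have : p * p <= p ^ j.+2 by rewrite !expnS mulnA leq_pmulr // expn_gt0 p0.
    by move: pk2; rewrite /k; nia.
have := leS _ _ gainwise; rewrite !SD -/PX -/PY -/LX -/LY.
have -> : S (fun j => nat_of_bool (j == 0)) = 0.
  by rewrite /S big_nat_cond big1 // => j /andP[]; lia.
suff -> : S (fun j => nat_of_bool (j == 1)) = 1 by lia.
rewrite /S big_ltn ?eqxx; last by rewrite ltnS /b; lia.
by rewrite big_nat_cond big1 // => j /andP[]; lia.
Qed.

(** * Size estimates *)

Lemma leq_exp_base (a b e : nat) : a <= b -> a ^ e <= b ^ e.
Proof. by case: e => // e ab; rewrite leq_exp2r. Qed.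

(** Clearing denominators, [step] is the Bernoulli-type bound
[(W / (W + 3)) ^ j >= 1 - 3 * j / W]. *)
Lemma exp_add3_le (W k : nat) : 6 * k <= W -> (W + 3) ^ k <= 2 * W ^ k.
Proof.
case: (posnP W) => [->|W0 hk]; first by case: k.
have step j : 3 * j <= W -> (W + 3) ^ j * (W - 3 * j) <= W ^ j * W.
  elim: j => [|j IH] hj; first by rewrite subn0.
  have := IH ltac:(lia); rewrite !expnS => h.
  have : (W + 3) * (W - 3 * j.+1) <= W * (W - 3 * j).
    have -> : W - 3 * j = (W - 3 * j.+1) + 3 by lia.
    have := leq_subr (3 * j.+1) W; move: (W - _) => d; nia.
  move: h; move: (_ ^ j) (_ ^ j) (W - 3 * j) (W - 3 * j.+1) => a b d e; nia.
rewrite -(leq_pmul2r W0); have h := step k ltac:(lia).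
apply: (@leq_trans (2 * ((W + 3) ^ k * (W - 3 * k)))); last first.
  by rewrite -mulnA leq_mul2l h.
by rewrite mulnCA leq_mul2l; apply/orP; right; lia.
Qed.

(** Each ratio [(y + i) / (x + i)] is at most [(W + 3) / W]. *)
Lemma prod_block_le (W x y k : nat) : W ^ 2 <= x -> y <= W ^ 2 + 3 * W ->
  6 * k <= W -> \prod_(y <= i < y + k) i <= 2 * \prod_(x <= i < x + k) i.
Proof.
move=> hx hy hk; case: (posnP W) => [W0|W0].
  by rewrite (_ : k = 0) ?addn0 ?big_geq //; lia.
have step n : \prod_(y <= i < y + n) i * W ^ n <=
              (W + 3) ^ n * \prod_(x <= i < x + n) i.
  elim: n => [|n IH]; first by rewrite !addn0 !big_geq.
  rewrite !(addnS _ n) !big_nat_recr ?leq_addr //= !(expnS _ n).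
  have : (y + n) * W <= (W + 3) * (x + n).
    by move: hx hy; rewrite expnS expn1; nia.
  move=> /(leq_mul IH).
  move: (\prod_(y <= _ < _) _) (\prod_(x <= _ < _) _) (W ^ n) ((W + 3) ^ n); lia.
have Wk : 0 < W ^ k by rewrite expn_gt0 W0.
rewrite -(leq_pmul2r Wk); apply: leq_trans (step k) _.
by rewrite [2 * _]mulnC -mulnA [_ * \prod_(_ <= _ < _) _]mulnC leq_mul2l exp_add3_le ?orbT.
Qed.

Lemma prod_tail_le (y k c Y : nat) : y + k + c <= Y ->
  \prod_(y <= i < y + (k + c)) i <= \prod_(y <= i < y + k) i * Y ^ c.
Proof.
elim: c => [|c IH] h; first by rewrite addn0 muln1.
rewrite addnS addnS big_nat_recr /=; last by lia.
rewrite expnSr mulnA; apply: leq_mul; [apply: IH|]; lia.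
Qed.

(** Put [T = 2 (5 W ^ 2) ^ c], the bound on the ratio of the two products.  By
[lcm_exchange] it is enough that [T * G * B ^ 2 < M].  After squaring, the
power of [w] in [T ^ 2] is [w ^ (4 * c)], which costs a single factor [M]; the
constant is [400 = 25 * 2 ^ 4].  The remaining inequality, multiplied by [G],
follows from [2 ^ n <= G * M]. *)
Lemma lcm_lt (r n c L w x y : nat) (k := r * r) (W := 6 * k * w)
    (M := medium_primorial r) (G := small_part r) (B := window_product k L) :
  1 < r -> n.*2 = k -> L < k -> 0 < c <= k -> 0 < w ->
  w ^ (4 * c) <= 2 ^ (4 * c) * M ->
  4 * 400 ^ c * (6 * k) ^ (4 * c) * G ^ 3 * B ^ 4 < 2 ^ n ->
  W ^ 2 <= x -> 0 < y <= W ^ 2 + 3 * W ->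
  (forall p, prime p -> r < p < k -> 0 < x %% p <= L) ->
  (forall p, prime p -> r < p < k ->
    exists t, [/\ 0 < t < p, t <= L & p %| y + t]) ->
  lcm_seq (index_iota y (y + (k + c))) < lcm_seq (index_iota x (x + k)).
Proof.
move=> r1 nk Lk /andP[c0 ck] w0 hw big hx /andP[y0 hy] resx resy.
have k1 : 1 < k by rewrite /k; nia.
have W0 : 6 * k <= W by rewrite /W leq_pmulr.
have x0 : 0 < x by apply: (leq_trans _ hx); rewrite sqrn_gt0; lia.
have := lcm_exchange r1 Lk x0 y0 c0 resx resy.
rewrite -/k -/M -/G -/B.
set lx := lcm_seq (index_iota x _); set ly := lcm_seq _.
have lx0 : 0 < lx by apply/lcm_seq_gt0/all_iota_gt0.
have ly0 : 0 < ly by apply/lcm_seq_gt0/all_iota_gt0.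
have prod0 a l : 0 < a -> 0 < \prod_(a <= i < a + l) i.
  by move=> a0; rewrite big_nat prodn_cond_gt0 // => i; lia.
have B0 : 0 < B := window_product_gt0 Lk.
have M0 : 0 < M := medium_primorial_gt0 r; have G0 : 0 < G := small_part_gt0 r.
set Px := \prod_(x <= i < _) i; set Py := \prod_(y <= i < _) i.
have Px0 : 0 < Px := prod0 x k x0.
have Py0 : 0 < Py := prod0 y (k + c) y0.
move=> /dvdn_leq; rewrite !muln_gt0 Py0 lx0 G0 B0 => /(_ isT) dvd.
pose T := 2 * (5 * W ^ 2) ^ c.
have PyT : Py <= T * Px.
  have h5 : y + k + c <= 5 * W ^ 2 by move: hy; rewrite expnS expn1; nia.
  apply: leq_trans (prod_tail_le h5) _.
  rewrite /T mulnAC leq_mul2r; apply/orP; right.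
  exact: prod_block_le hx hy W0.
have TM : T * (G * B ^ 2) < M.
  have ML : 2 ^ n <= G * M := chebyshev_lower r1 nk.
  have T2 : T ^ 2 <= 4 * 400 ^ c * (6 * k) ^ (4 * c) * M.
    have -> : T ^ 2 = 4 * (25 ^ c * ((6 * k) ^ (4 * c) * w ^ (4 * c))).
      have e : (5 * W ^ 2) ^ 2 = 25 * W ^ 4 by rewrite expnMn -expnM.
      by rewrite /T expnMn -expnM (mulnC c 2) expnM e expnMn -(expnM W) -expnMn.
    have -> : 400 ^ c = 25 ^ c * 2 ^ (4 * c) by rewrite expnM -expnMn.
    rewrite -!mulnA leq_mul2l leq_mul2l; apply/orP; right; apply/orP; right.
    by rewrite mulnCA leq_mul2l hw orbT.
  set A := 4 * 400 ^ c * (6 * k) ^ (4 * c) in big T2.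
  have lt_M : A * (G ^ 2 * B ^ 4) < M.
    rewrite -(ltn_pmul2l G0); apply: leq_trans ML; apply: leq_trans big.
    by rewrite [G ^ 3]expnS mulnCA !mulnA.
  rewrite -ltn_sqr expnMn expnMn -(expnM B).
  apply: leq_ltn_trans (leq_mul T2 (leqnn _)) _.
  by rewrite mulnAC [M ^ 2]expnS expn1 ltn_pmul2r.
rewrite ltnNge; apply/negP => le_l.
have : Py * lx * (G * B ^ 2) < M * (Px * ly).
  apply: (@leq_ltn_trans (T * Px * ly * (G * B ^ 2))).
    by rewrite leq_mul2r; apply/orP; right; apply: leq_mul.
  have -> : T * Px * ly * (G * B ^ 2) = T * (G * B ^ 2) * (Px * ly) by lia.
  by rewrite ltn_pmul2r // muln_gt0 Px0.
by rewrite ltnNge dvd.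
Qed.

(** With [L] of size [k / 4 ^ u], the exponent of 2 on the left is at most
[m * u * L * (32 + 29 * c)], while the one on the right is [L * 4 ^ u / 2].
The former is smaller because [u] is at least [2 * m * (32 + 29 * c)], so
that twice it is at most [L * u ^ 2 < L * 4 ^ u]. *)
Lemma parameters_suffice (m u c : nat) (r := 2 ^ (m * u)) (k := r * r)
    (L := 2 ^ (2 * u * (m - 1))) :
  1 < m -> 2 * m * (32 + 29 * c) <= u ->
  4 * 400 ^ c * (6 * k) ^ (4 * c) * small_part r ^ 3 * window_product k L ^ 4
    < 2 ^ (2 ^ (2 * m * u - 1)).
Proof.
move=> m1 hu; have u0 : 0 < u by nia.
have mu0 : 0 < m * u by rewrite muln_gt0; lia.
have kE : k = 2 ^ (2 * (m * u)) by rewrite /k /r -expnD; congr (2 ^ _); lia.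
have L0 : 0 < L by rewrite expn_gt0.
have kL : k = L * 2 ^ (2 * u) by rewrite kE /L -expnD; congr (2 ^ _); nia.
have u2 : u ^ 2 < 2 ^ (2 * u) by rewrite mulnC expnM ltn_sqr ltn_expl.
have Lk : L < k by rewrite kL -[X in X < _]muln1 ltn_pmul2l // -{1}(expn0 2) ltn_exp2l; lia.
have rL : r <= L by rewrite leq_exp2l; nia.
have hG : small_part r <= 2 ^ (2 * (m * u) * L).
  have r0 : 0 < r by rewrite expn_gt0.
  apply: leq_trans (small_part_le r0) _; rewrite -/k kE -expnM leq_exp2l //.
  by rewrite leq_mul2l rL orbT.
have hB : window_product k L <= 2 ^ ((2 * (m * u) + 1) * (2 * L)).
  apply: leq_trans (window_product_le Lk) _.
  by rewrite [in X in X <= _]kE -expnS -expnM addn1.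
have h6 : (6 * k) ^ (4 * c) <= 2 ^ ((2 * (m * u) + 3) * (4 * c)).
  rewrite [X in _ <= X]expnM; apply: leq_exp_base.
  by rewrite [in X in X <= _]kE expnD mulnC leq_mul2l orbT.
have h400 : 400 ^ c <= 2 ^ (9 * c).
  by rewrite [X in _ <= X]expnM; apply: leq_exp_base.
have half : (2 ^ (2 * m * u - 1)).*2 = L * 2 ^ (2 * u).
  rewrite -kL kE -mul2n -expnS; congr (2 ^ _); lia.
pose E := 2 + 9 * c + (2 * (m * u) + 3) * (4 * c) + 2 * (m * u) * L * 3 +
  (2 * (m * u) + 1) * (2 * L) * 4.
apply: (@leq_ltn_trans (2 ^ E)).
  have -> : 2 ^ E = 2 ^ 2 * 2 ^ (9 * c) * 2 ^ ((2 * (m * u) + 3) * (4 * c)) *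
      2 ^ (2 * (m * u) * L * 3) * 2 ^ ((2 * (m * u) + 1) * (2 * L) * 4).
    by rewrite -!expnD.
  apply: leq_mul; last by rewrite [X in _ <= X]expnM; apply: leq_exp_base.
  apply: leq_mul; last by rewrite [X in _ <= X]expnM; apply: leq_exp_base.
  by apply: leq_mul => //; apply: leq_mul.
rewrite ltn_exp2l //.
suff : E <= m * u * L * (32 + 29 * c).
  move=> hE; suff : 2 * (m * u * L * (32 + 29 * c)) < L * 2 ^ (2 * u) by lia.
  apply: (@leq_ltn_trans (L * u ^ 2)); last by rewrite ltn_pmul2l.
  have -> : 2 * (m * u * L * (32 + 29 * c)) = L * u * (2 * m * (32 + 29 * c)) by lia.
  by rewrite -[u ^ 2]mulnn (mulnA L u u) leq_mul2l hu orbT.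
rewrite /E; move: (m * u) mu0 => a a0.
have cL : c * a <= c * (a * L) by rewrite leq_mul2l leq_pmulr // orbT.
have cc : c <= c * a by rewrite leq_pmulr.
have aL : L <= a * L by rewrite leq_pmull.
lia.
Qed.

Local Open Scope ring_scope.

(** * The two applications of the sieve *)

Lemma sieve_prime_square (R : realType) (r p : nat) :
  sieve_prime R (r * r) p = prime p && (r < p < r * r)%N.
Proof.
by rewrite /sieve_prime natrM -expr2 sqrtr_sqr ger0_norm // ltr_nat.
Qed.

Lemma sieve_modulus_square (R : realType) (r : nat) :
  sieve_modulus R (r * r) = medium_primorial r.
Proof.
apply: eq_bigl => p.
by rewrite sieve_prime_square ltn_ord andbT.
Qed.

(** For [k = b ^ m] the right-hand side is [k ^ (1 - 1 / m)]: the residues that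
the sieve allows are bounded by an integer that does not depend on [p]. *)
Lemma powR_shift_le (R : realType) (delta : R) (b m p : nat) : (0 < m)%N ->
  (0 < b)%N -> m%:R^-1 <= delta <= 1 -> (p <= b ^ m)%N ->
  (p%:R : R) `^ (1 - delta) <= (b ^ (m - 1))%:R.
Proof.
move=> m0 b0 /andP[hm d1] pk.
have b1 : (1 : R) <= b%:R by rewrite ler1n.
apply: (@le_trans _ _ (((b ^ m)%:R : R) `^ (1 - delta))).
  by apply: ge0_ler_powR; rewrite ?nnegrE ?ler_nat ?subr_ge0.
apply: (@le_trans _ _ (((b ^ m)%:R : R) `^ (1 - m%:R^-1))).
  by apply: ler_powR; rewrite ?ler1n ?expn_gt0 ?b0 // lerD2l lerN2.
have bm : 0 <= b%:R :> R by rewrite ler0n.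
rewrite natrX -powR_mulrn // -powRrM mulrBr mulr1 divff ?pnatr_eq0 -?lt0n //.
by rewrite -[X in _ - X]/(1%:R) -natrB // powR_mulrn // natrX.
Qed.

Lemma residue_le (R : realType) (delta : R) (L p : nat) (a : int) :
  (p%:R : R) `^ (1 - delta) <= L%:R -> a \in residue_set delta p ->
  1 <= a <= L%:Z.
Proof.
move=> hL; rewrite inE => /andP[-> /=] /le_trans; apply.
by rewrite ceil_le_int -pmulrn.
Qed.

(** Rounding up at most doubles the root, as the root is at least 1. *)
Lemma ceil_root_pow (R : realType) (M d : nat) : (0 < M)%N -> (0 < d)%N ->
  exists w : nat, [/\ Num.ceil ((M%:R : R) `^ d%:R^-1) = w%:Z, (0 < w)%N &
    (w ^ d <= 2 ^ d * M)%N].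
Proof.
move=> M0 d0; set a := _ `^ _.
have a1 : 1 <= a.
  have := @ler_powR R M%:R; rewrite ler1n => /(_ M0 0 d%:R^-1).
  by rewrite powRr0; apply; rewrite invr_ge0 ler0n.
have ceil_gt0 : 0 < Num.ceil a by rewrite ceil_gt0; lra.
exists `|Num.ceil a|%N; have wE : (`|Num.ceil a|%N)%:Z = Num.ceil a.
  by rewrite gez0_abs // ltW.
split=> //; first by rewrite absz_gt0 gt_eqF.
rewrite -(ler_nat R) natrM !natrX.
have -> : M%:R = a ^+ d :> R.
  by rewrite -powR_mulrn ?(le_trans _ a1) // -powRrM mulVf ?powRr1 // pnatr_eq0 -lt0n.
rewrite -exprMn; apply: lerXn2r; rewrite ?nnegrE ?ler0n //; first lra.
by rewrite pmulrn wE; have := ceil_itv a; lra.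
Qed.

Lemma nat_range_iota (R : realType) (C : R) (y k : nat) : 1 <= C ->
  nat_range y (y%:R + k%:R + C - 1) = index_iota y (y + (k + Num.truncn C)).
Proof.
move=> C1; rewrite /nat_range; congr index_iota.
have C0 : 0 <= C by lra.
have /andP[h1 h2] := truncn_itv C0.
have : (0 < Num.truncn C)%N by rewrite truncn_gt0.
case: (Num.truncn C) h1 h2 => // c h1 h2 _.
rewrite (@truncn_def _ _ (y + k + c)%N); first lia.
by move: h1 h2; rewrite -!natr1 !natrD; lra.
Qed.

(** The sieve is used twice: in [W ^ 2, W ^ 2 + w[ for [x], and in an interval of
the same length from [- (W ^ 2 + 3 * W)] for [- y].  A residue of [- y] in
[1, L] means that [y] lies just below a multiple of [p].  The gap of about
[3 * W] ensures [x + k < y]. *)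
Lemma sieve_pair (R : realType) (HS : sieve_hypothesis R) (c : nat) : (0 < c)%N ->
  exists r n L w x y : nat, let k := (r * r)%N in let W := (6 * k * w)%N in
  [/\ (1 < r)%N /\ (n.*2 = k)%N, (L < k)%N /\ (c <= k)%N,
      (0 < w)%N /\ (w ^ (4 * c) <= 2 ^ (4 * c) * medium_primorial r)%N,
      (4 * 400 ^ c * (6 * k) ^ (4 * c) * small_part r ^ 3 *
         window_product k L ^ 4 < 2 ^ n)%N &
   [/\ (W ^ 2 <= x)%N, (x + k < y)%N, (y <= W ^ 2 + 3 * W)%N,
    (forall p, prime p -> r < p < k -> 0 < x %% p <= L)%N &
    (forall p, prime p -> r < p < k ->
      exists t, [/\ 0 < t < p, t <= L & p %| y + t])%N]].
Proof.
move=> c0; pose d := (4 * c)%N; have d0 : (0 < d)%N by rewrite muln_gt0.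
have eps0 : 0 < d%:R^-1 :> R by rewrite invr_gt0 ltr0n.
have [delta [/andP[delta0 deltae] [k0 HS0]]] := HS _ eps0.
have delta1 : delta <= 1.
  by apply: le_trans (ltW deltae) _; rewrite invf_le1 ?ler1n ?ltr0n.
have [m m1 hm] : exists2 m, (1 < m)%N & m%:R^-1 <= delta.
  exists (Num.truncn delta^-1).+2 => //.
  rewrite invf_ple ?posrE ?ltr0n //; apply: ltW; apply: lt_le_trans (truncnS_gt _) _.
  by rewrite ler_nat.
have [u hu k0u] : exists2 u, (2 * m * (32 + 29 * c) <= u)%N & (k0 <= u)%N.
  by exists (2 * m * (32 + 29 * c) + k0)%N; rewrite ?leq_addr ?leq_addl.
pose r := (2 ^ (m * u))%N; pose k := (r * r)%N; pose b := (2 ^ (2 * u))%N.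
have kE : k = (b ^ m)%N by rewrite /k /r /b -expnM -expnD; congr (2 ^ _)%N; lia.
pose L := (2 ^ (2 * u * (m - 1)))%N.
have u0 : (0 < u)%N by nia.
have b1 : (1 < b)%N by rewrite /b -{1}(expn0 2) ltn_exp2l // muln_gt0.
have LE : L = (b ^ (m - 1))%N by rewrite /L expnM.
have Lk : (L < k)%N by rewrite LE kE ltn_exp2l //; lia.
have r1 : (1 < r)%N by rewrite /r -{1}(expn0 2) ltn_exp2l // muln_gt0; lia.
have uk : (u < k)%N.
  have : (u <= m * u)%N by rewrite leq_pmull //; lia.
  have := ltn_expl (m * u) (isT : 1 < 2)%N; rewrite -/r /k => ? ?.
  have : (r <= r * r)%N by rewrite leq_pmulr //; lia.
  lia.
have sieveE := sieve_prime_square R r.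
have M0 := medium_primorial_gt0 r.
have [w [wE w0 wd]] := ceil_root_pow R M0 d0.
have block (a : int) := HS0 k (leq_trans k0u (ltnW uk)) a.
rewrite sieve_modulus_square wE in block.
have small p (a : int) : (p < k)%N -> a \in residue_set delta p -> 1 <= a <= L%:Z.
  move=> pk; apply: residue_le; rewrite LE.
  by apply: powR_shift_le; [exact: ltnW | exact: ltnW | rewrite hm | rewrite -kE ltnW].
pose W := (6 * k * w)%N.
have [x [/andP[x1 x2] resx]] := block (W ^ 2)%N%:Z.
have [z [/andP[z1 z2] resz]] := block (- (W ^ 2 + 3 * W)%N%:Z).
have kW : (k + 2 * w <= 3 * W)%N by rewrite /W; nia.
exists r, (2 ^ (2 * m * u - 1))%N, L, w, `|x|%N, `|z|%N => /=.
rewrite -/k -/W.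
split; [split| split | | |split] => //.
- rewrite -mul2n -expnS kE /b -expnM; congr (2 ^ _)%N.
  by have : (0 < m * u)%N; [rewrite muln_gt0; lia | lia].
- apply: leq_trans (ltnW uk); apply: leq_trans hu.
  by apply: (@leq_trans (32 + 29 * c)); [lia | rewrite leq_pmull //; lia].
- exact: parameters_suffice.
- lia.
- lia.
- lia.
- move=> p pp /andP[rp pk].
  have := small p _ pk (resx p _); rewrite sieveE pp rp pk => /(_ isT).
  have -> : x = `|x|%N%:Z by rewrite gez0_abs //; lia.
  by rewrite modz_nat /=; lia.
- move=> p pp /andP[rp pk].
  have := small p _ pk (resz p _); rewrite sieveE pp rp pk => /(_ isT).
  have p0 : p%:Z != 0 by have := prime_gt0 pp; lia.
  have := ltz_pmod z (_ : 0 < p%:Z); have := divz_eq z p%:Z.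
  move: (z %% p%:Z)%Z (z %/ p%:Z)%Z => t q e /(_ (prime_gt0 pp)) tp tL.
  exists `|t|%N; split; [lia|lia|].
  suff : (p%:Z %| (`|z| + `|t|)%N%:Z)%Z by [].
  apply/dvdzP; exists (- q); lia.
Qed.

Theorem mainTheorem2 (R : realType) (HS : sieve_hypothesis R)
    (C : R) (hC : 1 <= C) :
  exists k x y : nat,
    [/\ (1 <= k)%N, (0 < x)%N, (x < y)%N, (x + k < y)%N &
        (lcm_seq (nat_range y (y%:R + k%:R + C - 1))
           < lcm_seq (index_iota x (x + k)))%N].
Proof.
have c0 : (0 < Num.truncn C)%N by rewrite truncn_gt0.
have [r [n [L [w [x [y]]]]]] := sieve_pair HS c0.
move=> [[r1 nk] [Lk ck] [w0 wd] big [xW xy yW resx resy]].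
have x0 : (0 < x)%N.
  by apply: leq_trans xW; rewrite sqrn_gt0 !muln_gt0 w0 /= !andbT; lia.
exists (r * r)%N, x, y; split => //; [lia | lia |].
rewrite nat_range_iota //; apply: (lcm_lt r1 nk Lk _ w0 wd big xW) => //.
- by rewrite c0.
- by rewrite yW andbT; lia.
Qed.
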